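(* Let $\Bbbk$ be a field of characteristic zero and let $L$ be a finite-dimensional postLie algebra over $\Bbbk$ with property $A_{\mathrm{postAs}}$. If nonzero elements $x,y\in L$ and scalars $\lambda,\mu\in\Bbbk$ with $\lambda\neq0$ satisfy $$x\triangleright x=\lambda x,\qquad x\triangleright y=\mu y,$$ then $\mu/\lambda\in\mathbb Z$.
   Context: All algebras are over the field $\Bbbk$ of characteristic zero, and $\mathbb Z$ is regarded as a subring of $\Bbbk$. A postLie algebra is a vector space $L$ with a Lie bracket $\{\,,\,\}$ (the initial bracket) and a bilinear product $\triangleright$ such that, writing $D_x(y)=x\triangleright y$, every $D_x$ is a derivation of the Lie algebra $(L,\{\,,\,\})$, i.e. $D_x\{y,z\}=\{D_xy,z\}+\{y,D_xz\}$, and $D_xD_y-D_yD_x=D_{[x,y]}$ where $[x,y]=\{x,y\}+x\triangleright y-y\triangleright x$. Homomorphisms of postLie algebras are linear maps preserving both $\{\,,\,\}$ and $\triangleright$. A postassociative algebra is a vector space with three bilinear operations $\prec,\succ,\cdot$ such that $\cdot$ is associative and, for all $a,b,c$, $(a\prec b)\prec c=a\prec(b*c)$, $(a\succ b)\prec c=a\succ(b\prec c)$, $(a*b)\succ c=a\succ(b\succ c)$, $(a\succ b)\cdot c=a\succ(b\cdot c)$, $(a\prec b)\cdot c=a\cdot(b\succ c)$, $(a\cdot b)\prec c=a\cdot(b\prec c)$, where $a*b=a\succ b+a\prec b+a\cdot b$. Its induced postLie algebra is the same vector space with $\{a,b\}=a\cdot b-b\cdot a$ and $a\triangleright b=a\succ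 b-b\prec a$. A finite-dimensional postLie algebra $L$ has property $A_{\mathrm{postAs}}$ if it embeds (via an injective homomorphism of postLie algebras) into the induced postLie algebra of a finite-dimensional postassociative algebra. *)

(* Defs.v *)
From HB Require Import structures.
From mathcomp Require Import all_boot all_order all_algebra.
From mathcomp Require Import ring.

Set Implicit Arguments.
Unset Strict Implicit.
Unset Printing Implicit Defensive.

Import GRing.Theory VectorInternalTheory.
Local Open Scope ring_scope.

Record postLie (k : fieldType) (L : vectType k) := PostLie {
  pl_bracket : {bilinear L -> L -> L};
  pl_tri : {bilinear L -> L -> L};
  pl_bracketxx : forall x, pl_bracket x x = 0;
  pl_jacobi : forall x y z,
    pl_bracket x (pl_bracket y z) + pl_bracket y (pl_bracket z x)
    + pl_bracket z (pl_bracket x y) = 0;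
  pl_derivation : forall x y z,
    pl_tri x (pl_bracket y z) =
    pl_bracket (pl_tri x y) z + pl_bracket y (pl_tri x z);
  pl_commutator : forall x y z,
    pl_tri x (pl_tri y z) - pl_tri y (pl_tri x z) =
    pl_tri (pl_bracket x y + pl_tri x y - pl_tri y x) z
}.

Record postAs (k : fieldType) (A : vectType k) := PostAs {
  pa_prec : {bilinear A -> A -> A};
  pa_succ : {bilinear A -> A -> A};
  pa_dot : {bilinear A -> A -> A};
  pa_star := fun a b : A => pa_succ a b + pa_prec a b + pa_dot a b;
  pa_dotA : forall a b c, pa_dot (pa_dot a b) c = pa_dot a (pa_dot b c);
  pa_prec_prec : forall a b c,
    pa_prec (pa_prec a b) c = pa_prec a (pa_star b c);
  pa_succ_prec : forall a b c,
    pa_prec (pa_succ a b) c = pa_succ a (pa_prec b c);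
  pa_star_succ : forall a b c,
    pa_succ (pa_star a b) c = pa_succ a (pa_succ b c);
  pa_succ_dot : forall a b c,
    pa_dot (pa_succ a b) c = pa_succ a (pa_dot b c);
  pa_prec_dot : forall a b c,
    pa_dot (pa_prec a b) c = pa_dot a (pa_succ b c);
  pa_dot_prec : forall a b c,
    pa_prec (pa_dot a b) c = pa_dot a (pa_prec b c)
}.

Section InducedPostLie.
Variables (k : fieldType) (A : vectType k) (P : postAs A).

Definition ind_bracket (a b : A) : A := pa_dot P a b - pa_dot P b a.
Definition ind_tri (a b : A) : A := pa_succ P a b - pa_prec P b a.

(* [ring] does not apply to vectors, so linear identities are checked on the
   coordinates given by [v2r]. *)
Local Ltac by_coordinates :=
  apply: (can_inj v2rK); apply/rowP => ?;
  rewrite ?(linear0, linearD, linearN, linearZ, mxE) /=; ring.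

Local Ltac expand :=
  rewrite ?(linearBl, linearBr, linearDl, linearDr, linearNl, linearNr,
            linearZl_LR, linearZr_LR) /=.

Lemma ind_bracket_bilinear : bilinear_for *:%R *:%R ind_bracket.
Proof.
by split=> z c x y; rewrite /ind_bracket /=; expand; by_coordinates.
Qed.

Lemma ind_tri_bilinear : bilinear_for *:%R *:%R ind_tri.
Proof.
by split=> z c x y; rewrite /ind_tri /=; expand; by_coordinates.
Qed.

HB.instance Definition _ :=
  bilinear_isBilinear.Build k A A A *:%R *:%R ind_bracket ind_bracket_bilinear.
HB.instance Definition _ :=
  bilinear_isBilinear.Build k A A A *:%R *:%R ind_tri ind_tri_bilinear.

Lemma ind_bracketxx x : ind_bracket x x = 0.
Proof. exact: subrr. Qed.

Lemma ind_jacobi x y z :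
  ind_bracket x (ind_bracket y z) + ind_bracket y (ind_bracket z x)
  + ind_bracket z (ind_bracket x y) = 0.
Proof. by rewrite /ind_bracket; expand; rewrite !pa_dotA; by_coordinates. Qed.

Lemma ind_derivation x y z :
  ind_tri x (ind_bracket y z) =
  ind_bracket (ind_tri x y) z + ind_bracket y (ind_tri x z).
Proof.
rewrite /ind_tri /ind_bracket; expand.
by rewrite !pa_succ_dot !pa_dot_prec !pa_prec_dot; by_coordinates.
Qed.

Lemma ind_commutator x y z :
  ind_tri x (ind_tri y z) - ind_tri y (ind_tri x z) =
  ind_tri (ind_bracket x y + ind_tri x y - ind_tri y x) z.
Proof.
have star_succ a b c := pa_star_succ P a b c.
have prec_prec a b c := pa_prec_prec P a b c.
rewrite /ind_tri /ind_bracket; expand.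
rewrite !pa_succ_prec -!star_succ !prec_prec /pa_star; expand.
by_coordinates.
Qed.

Definition induced_postLie : postLie A :=
  @PostLie k A ind_bracket ind_tri
    ind_bracketxx ind_jacobi ind_derivation ind_commutator.

End InducedPostLie.

Definition postLie_morphism (k : fieldType) (L M : vectType k)
    (PL : postLie L) (PM : postLie M) (f : {linear L -> M}) : Prop :=
  (forall x y, f (pl_bracket PL x y) = pl_bracket PM (f x) (f y)) /\
  (forall x y, f (pl_tri PL x y) = pl_tri PM (f x) (f y)).

Definition property_A_postAs (k : fieldType) (L : vectType k)
    (PL : postLie L) : Prop :=
  exists (A : vectType k) (PA : postAs A) (f : {linear L -> A}),
    injective f /\ postLie_morphism PL (induced_postLie PA) f.

(* Main.v *)
Require Import Defs.
From HB Require Import structures.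
From mathcomp Require Import all_boot all_order all_algebra.
From mathcomp Require Import ring.
From Stdlib Require Import Classical.

(** Inside the postassociative algebra, [x ▷ _] is [D = l - r], where
[l u = x ≻ u] and [r u = u ≺ x] commute.  The theorem follows from a statement
on the spectra: in an algebraic closure, every eigenvalue of [l] and of [r]
is an integer multiple of [lam], hence so is every eigenvalue of [D].

To see this, let [Q] be a polynomial with zero constant term that vanishes at
the spectral values lying in [Z lam] and takes the value 1 at all others, to
high order.  As [⋆] is associative, [e = Q(x)], computed with the product [⋆], is
an idempotent; as [≻] and [≺] are a left and a right action of [A] with this
product, [e ≻ _ = Q(l)] and [_ ≺ e = Q(r)].  It suffices that [e = 0].  Two facts
give this.

- [D x = lam x] and [D] is a derivation of the product [·], so [e] is a sum of
eigenvectors of [D] with eigenvalues [m lam], [m >= 1] ([star_poly_weight]).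
On such vectors the eigenvalues of [l] and [r] differ by [m lam], so [Q] does
not distinguish them: [e ≻ v = v ≺ e] ([projections_agree]).

- Expanding [e ⋆ e = e] with [f = e ≻ e = e ≺ e] gives [f · f = - f] and
[(e - f) · (e - f) = e - f] ([succ_prec_idempotent]).  But the product [·]
adds the positive weights, so an element of positive weight that is
proportional to its square vanishes ([positive_weight_idempotent0]).  Hence
[f = 0] and [e = 0].

All of this is carried out over the ground field: the joint eigenvectors are
replaced by vectors killed by a product of linear factors in one operator and
by a polynomial without the corresponding roots in the other
([commuting_eigen]). *)

Set Implicit Arguments.
Unset Strict Implicit.
Unset Printing Implicit Defensive.

Import GRing.Theory VectorInternalTheory.
Local Open Scope ring_scope.

(** * Polynomials acting through a linear endomorphism *)

Section PolynomialAction.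
Variable k : fieldType.
Implicit Types (V W : lmodType k) (p q : {poly k}).

(** The action is defined on vectors, for any module and any map, because the
ring structure on the linear endomorphisms requires a nonzero space. *)
Definition peval V (F : V -> V) p (v : V) : V :=
  \sum_(i < size p) p`_i *: iter i F v.

Lemma iter_linear V (F : {linear V -> V}) n : linear (iter n F).
Proof. by elim: n => [|n IHn] a u v //=; rewrite IHn linearP. Qed.

Lemma peval_linear V (F : {linear V -> V}) p : linear (peval F p).
Proof.
move=> a u v; rewrite /peval scaler_sumr -big_split /=.
by apply: eq_bigr => i _; rewrite iter_linear scalerDr !scalerA mulrC.
Qed.

HB.instance Definition _ V (F : {linear V -> V}) p :=
  GRing.isLinear.Build k V V *:%R (peval F p) (peval_linear F p).

Lemma peval_wide V (F : V -> V) p n v : (size p <= n)%N ->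
  peval F p v = \sum_(i < n) p`_i *: iter i F v.
Proof.
move=> le_pn; rewrite /peval (big_ord_widen n (fun i => p`_i *: iter i F v)) //.
rewrite big_mkcond; apply: eq_bigr => i _; case: ltnP => // le_pi.
by rewrite nth_default // scale0r.
Qed.

Lemma pevalD V (F : V -> V) p q v :
  peval F (p + q) v = peval F p v + peval F q v.
Proof.
have le_max := size_polyD p q.
rewrite (peval_wide F v le_max) (peval_wide F v (leq_maxl (size p) (size q))).
rewrite (peval_wide F v (leq_maxr (size p) (size q))) -big_split /=.
by apply: eq_bigr => i _; rewrite coefD scalerDl.
Qed.

Lemma pevalZ V (F : V -> V) c p v : peval F (c *: p) v = c *: peval F p v.
Proof.
rewrite (peval_wide F v (size_scale_leq c p)) scaler_sumr.
by apply: eq_bigr => i _; rewrite coefZ scalerA.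
Qed.

Lemma pevalB V (F : V -> V) p q v :
  peval F (p - q) v = peval F p v - peval F q v.
Proof. by apply/eqP; rewrite eq_sym subr_eq -pevalD subrK. Qed.

Lemma pevalC V (F : V -> V) c v : peval F c%:P v = c *: v.
Proof.
rewrite (@peval_wide _ _ _ 1) ?size_polyC ?leq_b1 //.
by rewrite big_ord1 coefC.
Qed.

Lemma peval0 V (F : V -> V) v : peval F 0 v = 0.
Proof. by rewrite -[0]/(0%:P) pevalC scale0r. Qed.

Lemma peval1 V (F : V -> V) v : peval F 1 v = v.
Proof. by rewrite pevalC scale1r. Qed.

Lemma pevalMX V (F : V -> V) p v : peval F (p * 'X) v = peval F p (F v).
Proof.
rewrite (@peval_wide _ _ _ (size p).+1); last first.
  by rewrite (leq_trans (size_polyMleq _ _)) // size_polyX addn2.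
rewrite big_ord_recl coefMX eqxx scale0r add0r.
by apply: eq_bigr => i _; rewrite coefMX -iterSr.
Qed.

Lemma peval_intertwine V W (F : V -> V) (G : W -> W)
    (T : {linear V -> W}) p v :
  (forall u, T (F u) = G (T u)) -> T (peval F p v) = peval G p (T v).
Proof.
move=> TF; rewrite linear_sum; apply: eq_bigr => i _; rewrite linearZ /=.
by congr (_ *: _); elim: (i : nat) => //= n <-.
Qed.

Lemma pevalM V (F : {linear V -> V}) p q v :
  peval F (p * q) v = peval F p (peval F q v).
Proof.
elim/poly_ind: p v => [|p c IHp] v; first by rewrite mul0r !peval0.
rewrite mulrDl -mulrA ['X * q]mulrC mulrA !pevalD !pevalMX IHp pevalC.
by rewrite -(@peval_intertwine _ _ F F F) // mul_polyC pevalZ.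
Qed.

Lemma peval_XsubC V (F : V -> V) a v : peval F ('X - a%:P) v = F v - a *: v.
Proof.
by rewrite -['X]mul1r pevalB pevalMX peval1 pevalC.
Qed.

Lemma peval_eigen V (F : {linear V -> V}) a p v :
  F v = a *: v -> peval F p v = p.[a] *: v.
Proof.
move=> Fv; elim/poly_ind: p => [|p c IHp].
  by rewrite peval0 horner0 scale0r.
rewrite pevalD pevalMX pevalC Fv linearZ /= IHp !hornerE.
by rewrite scalerDl scalerA mulrC.
Qed.

Lemma peval_eq V (F G : {linear V -> V}) p v :
  (forall u, F (G u) = G (F u)) -> F v = G v -> peval F p v = peval G p v.
Proof.
move=> FG FGv; elim/poly_ind: p => [|p c IHp]; first by rewrite !peval0.
rewrite !pevalD !pevalMX !pevalC -[in RHS]FGv; congr (_ + _).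
rewrite -(@peval_intertwine _ _ F F F) // IHp.
by rewrite (@peval_intertwine _ _ G G F).
Qed.

(** The [n + 1] first powers of [F] are linearly dependent in the
[n]-dimensional space of endomorphisms; a dependency is read off the kernel of
the matrix of their coordinates. *)
Lemma peval_annihilator (V : vectType k) (F : {linear V -> V}) :
  exists2 p : {poly k}, p != 0 & forall v, peval F p v = 0.
Proof.
pose pw i := iter i (comp_lfun (linfun F)) \1%VF.
pose n := dim 'End(V).
pose M := \matrix_(i < n.+1) v2r (pw i).
have kerM : kermx M != 0.
  rewrite kermx_eq0 /row_free neq_ltn ltnS.
  by rewrite (leq_trans (rank_leq_col _)).
pose u := nz_row (kermx M).
have uM : u *m M = 0 by apply/sub_kermxP/nz_row_sub.
have u0 : u != 0 by rewrite nz_row_eq0.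
exists (\poly_(i < n.+1) u 0 (inord i)).
  apply: contraNneq u0 => p0; apply/eqP/rowP => i; rewrite !mxE.
  by have /polyP/(_ i) := p0; rewrite coef_poly ltn_ord inord_val coef0.
move=> v; rewrite (@peval_wide _ _ _ n.+1) ?size_poly //.
have: \sum_i u 0 i *: pw i = 0.
  apply: (can_inj v2rK); rewrite linear0 -uM mulmx_sum_row linear_sum /=.
  by apply: eq_bigr => i _; rewrite linearZ rowK.
move/lfunP/(_ v); rewrite sum_lfunE lfunE /= => sum0; rewrite -[RHS]sum0.
apply: eq_bigr => i _; rewrite coef_poly ltn_ord inord_val lfunE /=.
congr (_ *: _); elim: (i : nat) => [|j IHj]; first by rewrite id_lfunE.
by rewrite /= lfunE /= -IHj lfunE.
Qed.

(** This replaces joint eigenvectors in an algebraic closure.  If [w] were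
nonzero, applying some of the linear factors to it would give a nonzero [w']
with [G w' = a w'] for some [a] in [s].  Then [F w' = (a + c) w'], and as
[h(F)] kills [w'] the scalar [a + c] would be a root of [h]. *)
Lemma commuting_eigen V (F G : {linear V -> V}) (s : seq k) h c w :
  (forall u, F (G u) = G (F u)) -> F w - G w = c *: w ->
  peval G (\prod_(a <- s) ('X - a%:P)) w = 0 -> peval F h w = 0 ->
  (forall a, a \in s -> ~~ root h (a + c)) -> w = 0.
Proof.
move=> FG; elim: s => [|a s IHs] Fw; first by rewrite big_nil peval1.
rewrite big_cons pevalM peval_XsubC => /eqP; rewrite subr_eq0 => /eqP Gw' hw hs.
apply: IHs => //; last by move=> b bs; apply: hs; rewrite inE bs orbT.
set q := \prod_(_ <- s) _ in Gw' *.
have FGq u : F (peval G q u) = peval G q (F u) by apply: peval_intertwine.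
have Fw' : F (peval G q w) = (a + c) *: peval G q w.
  rewrite FGq -[F w](subrK (G w)) Fw linearD linearZ /=.
  by rewrite -(@peval_intertwine _ _ G G G) // Gw' scalerDl addrC.
have := peval_eigen h Fw'.
have -> : peval F h (peval G q w) = peval G q (peval F h w).
  by rewrite (@peval_intertwine _ _ F F (peval G q)) // => u; rewrite /= FGq.
rewrite hw linear0 => /esym/eqP.
by rewrite scaler_eq0 -/(root _ _) (negPf (hs _ _)) ?inE ?eqxx // => /eqP.
Qed.

End PolynomialAction.

(** * Isolating the roots of a given kind *)

Lemma split_roots (k : fieldType) (P : k -> Prop) (p : {poly k}) : p != 0 ->
  exists s h, [/\ p = (\prod_(a <- s) ('X - a%:P)) * h,
    forall a, a \in s -> P a & forall a, P a -> ~~ root h a].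
Proof.
have [n] := ubnP (size p); elim: n p => // n IHn p szp p0.
have [[a Pa /factor_theorem[q pE]]|noroot] :=
  classic (exists2 a, P a & root p a).
  have q0 : q != 0 by apply: contraNneq p0 => q0; rewrite pE q0 mul0r.
  have [|//|s [h [qE Ps Ph]]] := IHn q.
    by move: szp; rewrite pE size_Mmonic ?monicXsubC // size_XsubC addn2.
  exists (a :: s), h; split=> //; first by rewrite big_cons pE qE mulrC mulrA.
  by move=> b; rewrite inE => /predU1P[->|/Ps].
exists [::], p; split=> //; first by rewrite big_nil mul1r.
by move=> a Pa; apply/negP => pa; apply: noroot; exists a.
Qed.

(** * Weights of a derivation *)

Section Weights.
Variables (k : fieldType) (char0 : [pchar k] =i pred0).

(** The sum of the eigenspaces of [D] for the eigenvalues [i lam], [i >= m],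
generated as a predicate so that each closure property is an induction on the
number of eigenvectors in a sum. *)
Inductive weight_ge (V : lmodType k) (D : V -> V) (lam : k) (m : nat) :
    V -> Prop :=
| weight_ge0 : weight_ge D lam m 0
| weight_ge_add i u v : (m <= i)%N -> D u = (i%:R * lam) *: u ->
    weight_ge D lam m v -> weight_ge D lam m (u + v).

Section Basics.
Variables (V : lmodType k) (D : {linear V -> V}) (lam : k).

Lemma weight_geD m u v :
  weight_ge D lam m u -> weight_ge D lam m v -> weight_ge D lam m (u + v).
Proof.
elim=> [|i a b mi Da _ IH] Fv; first by rewrite add0r.
by rewrite -addrA; apply: weight_ge_add mi Da (IH Fv).
Qed.

Lemma weight_ge_eigen m i u : (m <= i)%N -> D u = (i%:R * lam) *: u ->
  weight_ge D lam m u.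
Proof.
move=> mi Du; rewrite -[u]addr0.
exact: weight_ge_add mi Du (weight_ge0 _ _ _).
Qed.

Lemma weight_ge_sub m n v : (m <= n)%N ->
  weight_ge D lam n v -> weight_ge D lam m v.
Proof.
move=> mn; elim=> [|i u w ni Du _ IH]; first exact: weight_ge0.
exact: weight_ge_add (leq_trans mn ni) Du IH.
Qed.

Lemma weight_ge_commute (T : {linear V -> V}) m v :
  (forall u, D (T u) = T (D u)) ->
  weight_ge D lam m v -> weight_ge D lam m (T v).
Proof.
move=> DT; elim=> [|i u w mi Du _ IH].
  by rewrite linear0; apply: weight_ge0.
by rewrite linearD; apply: weight_ge_add mi _ IH; rewrite DT Du linearZ.
Qed.

Lemma weight_geZ m c v : weight_ge D lam m v -> weight_ge D lam m (c *: v).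
Proof.
elim=> [|i u w mi Du _ IH]; first by rewrite scaler0; apply: weight_ge0.
rewrite scalerDr; apply: weight_ge_add mi _ IH.
by rewrite linearZ /= Du !scalerA mulrC.
Qed.

Lemma weight_ge_mul (mu : {bilinear V -> V -> V}) m n u v :
  (forall a b, D (mu a b) = mu (D a) b + mu a (D b)) ->
  weight_ge D lam m u -> weight_ge D lam n v ->
  weight_ge D lam (m + n) (mu u v).
Proof.
move=> Dmu Fu Fv; elim: Fu => [|i a w mi Da _ IH].
  by rewrite linear0l; apply: weight_ge0.
rewrite linearDl; apply: weight_geD IH.
elim: Fv => [|j b z nj Db _ IH]; first by rewrite linear0r; apply: weight_ge0.
rewrite linearDr; apply: weight_ge_add (leq_add mi nj) _ IH.
by rewrite Dmu Da Db linearZl_LR linearZr_LR -scalerDl -mulrDl -natrD.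
Qed.

End Basics.

Variables (V : vectType k) (D : {linear V -> V}) (lam : k) (lam0 : lam != 0).

(** A polynomial that kills [D] has finitely many roots, and in characteristic
zero the scalars [i lam] are pairwise distinct. *)
Lemma weight_ge_eventually0 :
  exists N, forall v, weight_ge D lam N v -> v = 0.
Proof.
have [p p0 pD] := peval_annihilator D.
suff [N rootN] : exists N, forall i, (N <= i)%N -> ~~ root p (i%:R * lam).
  exists N => v; elim=> // i u w Ni Du _ ->; rewrite addr0.
  have /esym/eqP := peval_eigen p Du.
  by rewrite pD scaler_eq0 -/(root _ _) (negPf (rootN _ Ni)) => /eqP.
have [s [h [-> _ noroot]]] :=
  split_roots (fun a => exists i, a = i%:R * lam) p0.
suff [N sN] : exists N, forall i, (N <= i)%N -> i%:R * lam \notin s.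
  exists N => i Ni; rewrite rootM root_prod_XsubC negb_or sN //=.
  by apply: noroot; exists i.
elim: s {noroot p p0 pD h} => [|a s [N sN]]; first by exists 0.
have [[j ->]|notin] := classic (exists j, a = j%:R * lam); last first.
  exists N => i Ni; rewrite inE negb_or sN // andbT.
  by apply/eqP => ai; apply: notin; exists i.
exists (maxn N j.+1) => i; rewrite geq_max => /andP[Ni ji].
rewrite inE negb_or sN // andbT (inj_eq (mulIf lam0)) -subr_eq0.
by rewrite -natrB 1?ltnW // (proj1 (pcharf0P _) char0) subn_eq0 -ltnNge.
Qed.

(** Squaring raises the weight, so [z] has arbitrarily large weight. *)
Lemma positive_weight_idempotent0 (mu : {bilinear V -> V -> V}) c z :
  (forall a b, D (mu a b) = mu (D a) b + mu a (D b)) ->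
  weight_ge D lam 1 z -> z = c *: mu z z -> z = 0.
Proof.
move=> Dmu Fz zE; have [N N0] := weight_ge_eventually0; apply: N0.
suff: weight_ge D lam N.+1 z by apply: weight_ge_sub.
elim: N => // n IHn; rewrite zE; apply: weight_geZ.
by rewrite -[n.+2]add1n; apply: weight_ge_mul.
Qed.

End Weights.

(** * Postassociative algebras *)

Section PostAssociative.
Variables (k : fieldType) (A : vectType k) (P : postAs A).

Local Notation "a ≺ b" := (pa_prec P a b) (at level 40, left associativity).
Local Notation "a ≻ b" := (pa_succ P a b) (at level 40, left associativity).
Local Notation "a · b" := (pa_dot P a b) (at level 40, left associativity).
Local Notation "a ⋆ b" := (pa_star P a b) (at level 40, left associativity).

(* [ring] does not apply to vectors, only to their coordinates. *)
Local Ltac by_coordinates :=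
  apply: (can_inj v2rK); apply/rowP => ?;
  rewrite ?(linear0, linearD, linearN, linearZ, mxE) /=; ring.

Local Ltac expand :=
  rewrite ?(linearBl, linearBr, linearDl, linearDr, linearNl, linearNr,
            linearZl_LR, linearZr_LR) /=.

Lemma pa_starE a b : a ⋆ b = a ≻ b + a ≺ b + a · b.
Proof. by []. Qed.

Fact pa_star_bilinear : bilinear_for *:%R *:%R (pa_star P).
Proof. by split=> z c u v; rewrite /= !pa_starE; expand; by_coordinates. Qed.

HB.instance Definition _ :=
  bilinear_isBilinear.Build k A A A *:%R *:%R (pa_star P) pa_star_bilinear.

(* The partial applications have a head constant of their own, on which the
   linear structure derived from the bilinear one is not inferred. *)
HB.instance Definition _ x :=
  GRing.isLinear.Build k A A *:%R (pa_star P x) (linearPr (pa_star P) x).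
HB.instance Definition _ x :=
  GRing.isLinear.Build k A A *:%R (ind_tri P x) (linearPr (ind_tri P) x).

Lemma pa_starA a b c : (a ⋆ b) ⋆ c = a ⋆ (b ⋆ c).
Proof.
rewrite [LHS]pa_starE pa_star_succ [RHS]pa_starE -pa_prec_prec.
rewrite ![in LHS]pa_starE ![in RHS]pa_starE; expand.
rewrite pa_succ_prec pa_succ_dot pa_prec_dot pa_dotA pa_dot_prec.
by_coordinates.
Qed.

(** On the right, [(a ≺ x) · b] and [a · (x ≻ b)] are equal and cancel. *)
Lemma ind_tri_dot x a b :
  ind_tri P x (a · b) = ind_tri P x a · b + a · ind_tri P x b.
Proof.
rewrite /ind_tri; expand; rewrite pa_succ_dot pa_dot_prec pa_prec_dot.
by_coordinates.
Qed.

(** The hypotheses turn [e ⋆ e = e] into [e = 2 f + e · e].  Applying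
[e ≻ _], which fixes [f] and sends [e · e] to [f · e = f · f], yields
[f = 2 f + f · f]. *)
Lemma succ_prec_idempotent e : e ⋆ e = e -> e ≻ e = e ≺ e ->
  let f := e ≻ e in f = -1 *: (f · f) /\ e - f = 1 *: ((e - f) · (e - f)).
Proof.
move=> ee eq_f f.
have Pf : e ≻ f = f by rewrite /f -pa_star_succ ee.
have fe : f · e = f · f.
  by rewrite -{2}/(e ≻ e) -pa_prec_dot /f pa_succ_prec -eq_f -/f Pf.
have ef : e · f = f · e by rewrite {1}/f -pa_prec_dot -eq_f.
have e_dot : e · e = e - (f + f).
  by rewrite -{3}ee pa_starE -eq_f -/f [f + f + _]addrC addrK.
have ff : f · f = - f.
  rewrite -fe /f pa_succ_dot e_dot linearBr linearDr /= Pf.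
  by rewrite opprD addrA subrr add0r.
split; first by rewrite ff scaleN1r opprK.
rewrite scale1r; expand; rewrite e_dot ef fe ff; by_coordinates.
Qed.

Section Powers.
Variable x : A.

Local Notation succ_x := (pa_succ P x).
Local Notation prec_x := (applyr (pa_prec P) x).
Local Notation star_x := (pa_star P x).

Lemma succ_prec_comm u : succ_x (prec_x u) = prec_x (succ_x u).
Proof. by rewrite /= pa_succ_prec. Qed.

(** For a polynomial [q], [peval star_x q x] is the value at [x], in the
associative algebra with product [⋆], of [q * 'X]: this algebra need not have a
unit, so only polynomials without constant term can be evaluated. *)
Lemma star_poly_succ q v : peval star_x q x ≻ v = peval succ_x (q * 'X) v.
Proof.
have := @peval_intertwine _ _ _ star_x succ_x (applyr (pa_succ P) v) q x.
by rewrite pevalMX => <- // u; rewrite /= pa_star_succ.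
Qed.

Lemma star_poly_prec q v : v ≺ peval star_x q x = peval prec_x (q * 'X) v.
Proof.
(* The right action reverses products, so [x] is factored out on the right. *)
have -> : peval star_x q x = peval (applyr (pa_star P) x) q x.
  apply: (@peval_eq _ _ star_x (applyr (pa_star P) x)) => // u.
  by rewrite /= pa_starA.
have := @peval_intertwine _ _ _ (applyr (pa_star P) x) prec_x (pa_prec P v) q x.
by rewrite pevalMX => <- // u; rewrite /= pa_prec_prec.
Qed.

Lemma star_poly_star q v : peval star_x q x ⋆ v = peval star_x (q * 'X) v.
Proof.
have := @peval_intertwine _ _ _ star_x star_x (applyr (pa_star P) v) q x.
by rewrite pevalMX => <- // u; rewrite /= pa_starA.
Qed.

Variables (lam : k) (Dx : ind_tri P x x = lam *: x).

Lemma ind_tri_succ u : ind_tri P x (succ_x u) = succ_x (ind_tri P x u).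
Proof. by rewrite /ind_tri pa_succ_prec linearB. Qed.

Lemma ind_tri_prec u : ind_tri P x (prec_x u) = prec_x (ind_tri P x u).
Proof. by rewrite /ind_tri /= linearBl /= pa_succ_prec. Qed.

(** By induction on [q], each of the three terms of [x ⋆ b] has positive weight
when [b], the value for [q], has: [x ≻ b] because [D] commutes with [x ≻ _]; [x · b]
because [D] is a derivation; and [x ≺ b] because it is a polynomial in
[_ ≺ x] applied to [x], hence, like [x], satisfies [D u = lam u]. *)
Lemma star_poly_weight q : weight_ge (ind_tri P x) lam 1 (peval star_x q x).
Proof.
have Fx : weight_ge (ind_tri P x) lam 1 x.
  by apply: (@weight_ge_eigen _ _ _ _ 1 1) => //; rewrite mul1r.
elim/poly_ind: q => [|q c IHq]; first by rewrite peval0; apply: weight_ge0.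
rewrite pevalD pevalC; apply: weight_geD; last exact: weight_geZ.
have -> : peval star_x (q * 'X) x = star_x (peval star_x q x).
  by rewrite pevalMX; symmetry; apply: peval_intertwine.
rewrite pa_starE; apply: weight_geD; first apply: weight_geD.
- exact: weight_ge_commute ind_tri_succ IHq.
- rewrite star_poly_prec; apply: (@weight_ge_commute _ _ _ _ (peval prec_x _)).
  + by move=> u; apply: peval_intertwine => w; apply: ind_tri_prec.
  + exact: Fx.
- apply: (@weight_ge_sub _ _ _ _ 1 2) => //.
  exact: (@weight_ge_mul _ _ _ _ (pa_dot P) 1 1 _ _ (ind_tri_dot x) Fx IHq).
Qed.

(** Here [Q] is 0 modulo [g], whose roots lie in [Z lam], and 1 modulo [h],
which has no such root, so [Q(l)] and [Q(r)] are commuting projections.  The image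
of [v] under [Q(l) (1 - Q(r))] is killed by [h(l)] and [g(r)]; since [l - r]
is [m lam] on it, a root of [g] shifted by [m lam] would be a root of [h],
so the image is zero.  The same holds with [l] and [r] exchanged. *)
Lemma projections_agree (s : seq k) (g h Q a b : {poly k}) m v :
    g = \prod_(c <- s) ('X - c%:P) ->
    (forall u, peval succ_x (g * h) u = 0) ->
    (forall u, peval prec_x (g * h) u = 0) ->
    (forall c, c \in s -> exists n : int, c = n%:~R * lam) ->
    (forall n : int, ~~ root h (n%:~R * lam)) ->
    Q = a * g -> 1 - Q = b * h ->
    ind_tri P x v = (m%:R * lam) *: v ->
  peval succ_x Q v = peval prec_x Q v.
Proof.
move=> gE ghl ghr sZ hZ Qg Qh Dv.
have gh0 (F : {linear A -> A}) r u :
    (forall w, peval F (g * h) w = 0) -> peval F (r * (g * h)) u = 0.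
  by move=> gh; rewrite pevalM gh linear0.
have comm p q u :
  peval succ_x p (peval prec_x q u) = peval prec_x q (peval succ_x p u).
  apply: peval_intertwine => w; symmetry; apply: peval_intertwine => z.
  exact/esym/succ_prec_comm.
have Dl p u : ind_tri P x (peval succ_x p u) = peval succ_x p (ind_tri P x u).
  by apply: peval_intertwine => w; apply: ind_tri_succ.
have Dr p u : ind_tri P x (peval prec_x p u) = peval prec_x p (ind_tri P x u).
  by apply: peval_intertwine => w; apply: ind_tri_prec.
have gQh : g * (1 - Q) = b * (g * h) by rewrite Qh mulrCA.
have hQg : h * Q = a * (g * h) by rewrite Qg mulrCA [h * g]mulrC.
have sepZ (n : int) c : c \in s -> ~~ root h (c + n%:~R * lam).
  by move=> /sZ[i ->]; rewrite -mulrDl -rmorphD; apply: hZ.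
have w1 : peval succ_x Q (peval prec_x (1 - Q) v) = 0.
  apply: (@commuting_eigen _ _ succ_x prec_x s h (m%:R * lam)) => //.
  - exact: succ_prec_comm.
  - by rewrite -/(ind_tri P x _) Dl Dr Dv !linearZ.
  - by rewrite -gE -comm -pevalM gQh gh0 ?linear0.
  - by rewrite -pevalM hQg gh0.
  - by move=> c; apply: (sepZ m).
have w2 : peval succ_x (1 - Q) (peval prec_x Q v) = 0.
  apply: (@commuting_eigen _ _ prec_x succ_x s h (- (m%:R * lam))) => //.
  - by move=> u; apply/esym/succ_prec_comm.
  - have E u : prec_x u - succ_x u = - ind_tri P x u by rewrite opprB.
    by rewrite E Dl Dr Dv !linearZ /= scalerN scaleNr.
  - by rewrite -gE -pevalM gQh gh0.
  - by rewrite -comm -pevalM hQg gh0 ?linear0.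
  - by move=> c; rewrite -mulNr -[m%:R]/(m%:Z%:~R) -mulrNz; apply: sepZ.
have PQ : peval succ_x Q v = peval succ_x Q (peval prec_x Q v).
  by apply/eqP; rewrite -subr_eq0 -linearB -w1 pevalB peval1.
by apply/eqP; rewrite PQ eq_sym -subr_eq0 -w2 pevalB peval1.
Qed.

(** Once [e = 0], both [g(l)] and [g(r)] kill [y], so two roots of [g] differ
by [mu]; both lie in [Z lam]. *)
Lemma ind_tri_eigenvalue y mu (char0 : [pchar k] =i pred0) :
  lam != 0 -> y != 0 -> ind_tri P x y = mu *: y ->
  exists n : int, mu = n%:~R * lam.
Proof.
move=> lam0 y0 Dy; pose Z c := exists n : int, c = n%:~R * lam.
have [pl pl0 plE] := peval_annihilator succ_x.
have [pr pr0 prE] := peval_annihilator prec_x.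
have [ps ps0 psE] := peval_annihilator star_x.
have [s [h [pE sZ hZ]]] := split_roots Z (mulf_neq0 (mulf_neq0 pl0 pr0) ps0).
set p := pl * pr * ps in pE; set g1 := \prod_(c <- s) _ in pE.
have pl_0 u : peval succ_x p u = 0.
  by rewrite /p -mulrA pevalM plE.
have pr_0 u : peval prec_x p u = 0.
  by rewrite /p mulrAC mulrC pevalM prE.
have ps_0 u : peval star_x p u = 0 by rewrite /p mulrC pevalM psE.
have hZ' n : ~~ root h (n%:~R * lam) by apply: hZ; exists n.
have zZ c : c \in 0 :: s -> Z c.
  by rewrite inE => /predU1P[->|/sZ//]; exists 0; rewrite mul0r.
(* The factor ['X] of [g] makes [Q] have zero constant term. *)
pose g := \prod_(c <- 0 :: s) ('X - c%:P).
have gX : g = g1 * 'X by rewrite /g big_cons subr0 mulrC.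
have gl u : peval succ_x (g * h) u = 0.
  by rewrite gX mulrAC -pE pevalM pl_0.
have gr u : peval prec_x (g * h) u = 0.
  by rewrite gX mulrAC -pE pevalM pr_0.
have /Bezout_eq1_coprimepP[[a b] /= ab1] : coprimep g h.
  rewrite coprimep_sym /g big_seq; elim/big_ind: _ => [|u v hu hv|c cs].
  - exact: coprimep1.
  - by rewrite coprimepMr hu.
  by rewrite coprimep_XsubC; have [n ->] := zZ _ cs.
pose q := a * g1; pose Q := q * 'X.
have QE : Q = a * g by rewrite gX mulrA.
have Q1 : 1 - Q = b * h by rewrite QE -ab1 addrAC subrr add0r.
pose e := peval star_x q x.
have Pe u : e ≻ u = peval succ_x Q u by apply: star_poly_succ.
have Re u : u ≺ e = peval prec_x Q u by apply: star_poly_prec.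
have ee : e ⋆ e = e.
  apply/eqP; rewrite eq_sym -subr_eq0 star_poly_star -/Q -{1}(peval1 star_x e).
  rewrite -pevalB Q1 -pevalM /q.
  have -> : b * h * (a * g1) = a * b * p by rewrite pE; ring.
  by rewrite pevalM ps_0 linear0.
have Fe : weight_ge (ind_tri P x) lam 1 e by apply: star_poly_weight.
have agree m v : ind_tri P x v = (m%:R * lam) *: v -> e ≻ v = v ≺ e.
  by rewrite Pe Re; apply: (@projections_agree (0 :: s) g h Q a b m v).
have agree_pos v : weight_ge (ind_tri P x) lam 1 v -> e ≻ v = v ≺ e.
  elim=> [|m u w _ Du _ IH]; first by rewrite linear0r linear0l.
  by rewrite linearDr linearDl /= (agree _ _ Du) IH.
have [fE eE] := succ_prec_idempotent ee (agree_pos _ Fe).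
have Ff : weight_ge (ind_tri P x) lam 1 (e ≻ e).
  rewrite Pe; apply: (@weight_ge_commute _ _ _ _ (peval succ_x Q)) => // u.
  by apply: peval_intertwine => w; apply: ind_tri_succ.
have idem0 := positive_weight_idempotent0 char0 lam0 (ind_tri_dot x).
have f0 : e ≻ e = 0 := idem0 _ _ Ff fE.
have e0 : e = 0.
  by move: eE; rewrite f0 subr0 => eE; apply: (idem0 _ _ Fe eE).
have kill (F : {linear A -> A}) :
    (forall u, peval F (g * h) u = 0) -> peval F Q y = 0 -> peval F g y = 0.
  move=> gh Qy; have -> : g = g * Q + b * (g * h).
    by rewrite [b * _]mulrCA -Q1 -mulrDr [Q + _]addrC subrK mulr1.
  by rewrite pevalD (pevalM F g Q) Qy (pevalM F b) gh !linear0 addr0.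
have gly : peval succ_x g y = 0 by rewrite kill // -Pe e0 linear0l.
have gry : peval prec_x g y = 0 by rewrite kill // -Re e0 linear0r.
have [//|notZ] := classic (Z mu).
case/eqP: y0; apply: (@commuting_eigen _ _ succ_x prec_x (0 :: s) g mu) => //.
  exact: succ_prec_comm.
move=> c /zZ[i ->]; rewrite root_prod_XsubC; apply/negP => /zZ[j ji].
by apply: notZ; exists (j - i); rewrite rmorphB mulrBl -ji addrC addKr.
Qed.

End Powers.
End PostAssociative.

(** * Eigenvalues in postLie algebras *)

Theorem corollary4p4 (k : fieldType) (char0 : [pchar k] =i pred0)
    (L : vectType k) (PL : postLie L) (hL : property_A_postAs PL)
    (x y : L) (hx : x != 0) (hy : y != 0)
    (lambda mu : k) (hlambda : lambda != 0)
    (hxx : pl_tri PL x x = lambda *: x)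
    (hxy : pl_tri PL x y = mu *: y) :
  exists n : int, mu / lambda = n%:~R.
Proof.
have [A [PA [f [f_inj [_ f_tri]]]]] := hL.
have fy : f y != 0 by rewrite -(linear0 f) (inj_eq f_inj).
have fxx : ind_tri PA (f x) (f x) = lambda *: f x.
  by rewrite -linearZ -hxx f_tri.
have fxy : ind_tri PA (f x) (f y) = mu *: f y.
  by rewrite -linearZ -hxy f_tri.
have [n ->] := ind_tri_eigenvalue fxx char0 hlambda fy fxy.
by exists n; rewrite mulfK.
Qed.
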